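(* Let $X=\mathbb{R}^k$, let $Y$ be a separable metric space, and let $f\colon X\to Y$ be a function. Let $\mathrm{Leb}$ denote the $\sigma$-algebra of Lebesgue measurable subsets of $\mathbb{R}^k$. Then the game $G^{\mathrm{Leb}}_f$ is determined (i.e. one of the two players has a winning strategy), and \begin{itemize} \item Player I has a winning strategy in $G^{\mathrm{Leb}}_f$ if and only if $f$ is not (Lebesgue) measurable; \item Player II has a winning strategy in $G^{\mathrm{Leb}}_f$ if and only if $f$ is (Lebesgue) measurable. \end{itemize}
   Context: For a $\sigma$-algebra $\Sigma$ of subsets of $X$, a function $f\colon X\to Y$ is $\Sigma$-measurable if $f^{-1}[U]\in\Sigma$ for every open $U\subseteq Y$; ''Lebesgue measurable'' means $\Sigma$-measurable with $\Sigma=\mathrm{Leb}$. Put $H(\Sigma):=\{A\subseteq X\colon \forall B\subseteq A,\ B\in\Sigma\}$ and $\Sigma^+:=\Sigma\setminus H(\Sigma)$. The game $G^\Sigma_f$: Player I first plays a set $W\in\Sigma^+$ and Player II answers with a set $U_0$; then at step $n>0$ Player I plays a point $x_n$ and Player II plays a set $U_n$ (order of moves: $W,U_0,x_1,U_1,x_2,U_2,\dots$), with the rules: $x_n\in U_{n-1}$ for every $n>0$; $U_n\in\Sigma^+$ and $U_n\subseteq W$ for every $n\ge 0$. Player II wins if $\langle x_n\rangle$ is convergent in $X$ and $\lim_{n\to\infty}f(x_n)=f(\lim_{n\to\infty}x_n)$ (in particular the limit on the left exists); otherwise Player I wins. The rules are binding: the first player who does not make a legal move loses. The Axiom of Choice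 is assumed. *)

(* Defs.v *)
From HB Require Import structures.
From mathcomp Require Import all_boot all_order all_algebra.
From mathcomp Require Import all_classical all_reals all_analysis.

Set Implicit Arguments.
Unset Strict Implicit.
Unset Printing Implicit Defensive.

Import Order.TTheory GRing.Theory Num.Theory.
Import numFieldNormedType.Exports.

Local Open Scope classical_set_scope.
Local Open Scope ring_scope.

Definition separable_space (Y : topologicalType) : Prop :=
  exists D : set Y, countable D /\ dense D.

Section LebesgueSigmaAlgebra.
Variables (R : realType) (k : nat).
Implicit Types (a b : 'rV[R]_k) (A : set 'rV[R]_k).

Definition box a b : set 'rV[R]_k :=
  [set x | forall i, a ord0 i < x ord0 i <= b ord0 i].

(* The truncation at 0 makes this the volume of [box a b] also when the box is
   empty. *)
Definition box_volume a b : R :=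
  \prod_(i < k) Num.max 0 (b ord0 i - a ord0 i).

(* Covers are families of boxes indexed by an arbitrary set [D] of naturals, so
   that finite and empty families are allowed; in dimension 0, where no box is
   empty, the empty family is needed for the empty set to have measure 0. *)
Definition box_cover A (D : pred nat) (a b : nat -> 'rV[R]_k) : Prop :=
  A `<=` \bigcup_(n in [set n | D n]) box (a n) (b n).

Definition lebesgue_outer_measure A : \bar R :=
  ereal_inf [set s | exists (D : pred nat) (a b : nat -> 'rV[R]_k),
    box_cover A D a b /\
    s = (\sum_(0 <= n <oo | D n) (box_volume (a n) (b n))%:E)%E].

Definition Leb : set (set 'rV[R]_k) :=
  lebesgue_outer_measure.-caratheodory.

End LebesgueSigmaAlgebra.

Definition sigma_measurable (X : Type) (Y : topologicalType)
    (Sigma : set (set X)) (f : X -> Y) : Prop :=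
  forall U : set Y, open U -> Sigma (f @^-1` U).

Definition hereditary_part (X : Type) (Sigma : set (set X)) : set (set X) :=
  [set A | forall B, B `<=` A -> Sigma B].

Definition positive_part (X : Type) (Sigma : set (set X)) : set (set X) :=
  Sigma `\` hereditary_part Sigma.

(* A run of the game, in the order of moves
     run_W, run_U 0, run_x 0, run_U 1, run_x 1, run_U 2, ...
   so that [run_x n] is the point usually written x_{n+1}. *)
Record run (X : Type) := Run {
  run_W : set X;
  run_U : nat -> set X;
  run_x : nat -> X }.

(* Strategies prescribe a move in every position, i.e. as a function of all the
   moves made so far: the set W, the sets U_i and the points x_i played. *)
Record strategyI (X : Type) := StrategyI {
  first_set : set X;
  next_point : set X -> seq (set X) -> seq X -> X }.

Definition strategyII (X : Type) := set X -> seq (set X) -> seq X -> set X.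

Definition followsI (X : Type) (s : strategyI X) (r : run X) : Prop :=
  run_W r = first_set s /\
  forall n, run_x r n =
    next_point s (run_W r) (mkseq (run_U r) n.+1) (mkseq (run_x r) n).

Definition followsII (X : Type) (s : strategyII X) (r : run X) : Prop :=
  forall n, run_U r n = s (run_W r) (mkseq (run_U r) n) (mkseq (run_x r) n).

Section Game.
Variables (X Y : topologicalType) (Sigma : set (set X)) (f : X -> Y).
Implicit Type r : run X.

(* Move number n of Player I directly precedes move number n of Player II. *)
Definition legalI r (n : nat) : Prop :=
  match n with
  | 0 => positive_part Sigma (run_W r)
  | m.+1 => run_U r m (run_x r m)
  end.

Definition legalII r (n : nat) : Prop :=
  positive_part Sigma (run_U r n) /\ run_U r n `<=` run_W r.

Definition first_illegalI r : Prop :=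
  exists n, ~ legalI r n /\
    (forall m, (m < n)%N -> legalI r m /\ legalII r m).

Definition first_illegalII r : Prop :=
  exists n, ~ legalII r n /\ legalI r n /\
    (forall m, (m < n)%N -> legalI r m /\ legalII r m).

Definition legal_run r : Prop := forall n, legalI r n /\ legalII r n.

Definition payoffII r : Prop :=
  exists l : X, run_x r @ \oo --> l /\ f (run_x r n) @[n --> \oo] --> f l.

Definition winsI r : Prop :=
  first_illegalII r \/ (legal_run r /\ ~ payoffII r).

Definition winsII r : Prop :=
  first_illegalI r \/ (legal_run r /\ payoffII r).

Definition has_winning_strategyI : Prop :=
  exists s : strategyI X, forall r, followsI s r -> winsI r.

Definition has_winning_strategyII : Prop :=
  exists s : strategyII X, forall r, followsII s r -> winsII r.

Definition determined : Prop :=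
  has_winning_strategyI \/ has_winning_strategyII.

End Game.

(* Main.v *)
Require Import Defs.
From HB Require Import structures.
From mathcomp Require Import all_boot all_order all_algebra.
From mathcomp Require Import all_classical all_reals all_analysis.
Import Order.TTheory GRing.Theory Num.Theory.
Import numFieldNormedType.Exports.
Local Open Scope classical_set_scope.
Local Open Scope ring_scope.

(** The sets all of whose subsets are measurable form a sigma-ideal, which
    contains every set of outer measure 0.  A measurable set is positive when it
    is outside this ideal; if a positive set is covered by countably many
    measurable sets, it is positive inside one of them.

    If [f] is measurable, Player II wins by answering at stage [n] with a
    closed positive subset of the previous set, of diameter about [1/n] and
    whose image under [f] has diameter about [1/n]
    ([shrinking_strategy_wins]).  The points played converge, the limit lies in
    every set played because these are closed, and so the value at the limit
    lies in every one of the shrinking images.  Such a subset exists because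
    the previous set is split into countably many measurable pieces by a grid
    of small closed cubes and by the preimages of small balls around a
    countable dense set ([measurable_winII]); one piece is positive, and
    positive sets contain closed positive sets
    ([Leb_has_positive_closed_subsets]).

    If the preimage [A] of some open set [V] is not measurable, it is the
    increasing union of the sets [A_m] of points whose value is at distance at
    least [1/m] from the complement of [V].  If for every [m] a measurable hull
    of [A_m] were contained in [A] up to a member of the ideal, then [A] would
    be measurable.  Hence for some [m] the hull [H] of [A_m] meets the
    complement of [A] in a set [C] outside the ideal; inside the intersection
    of [H] with a hull of [C], every positive set meets both [A_m] and [C]
    ([nonmeasurable_winI]).  Player I plays this intersection and then
    alternates between [A_m] and [C], which keeps consecutive values [1/m]
    apart ([alternating_strategy_wins]).

    Since the players cannot both win ([strategies_not_both_winning]), these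
    two implications give determinacy and both equivalences.

    On the measure side, the hulls and the closed subsets come from one fact,
    [outer_regular_null]: a set [B] of finite outer measure is contained in
    countably many open sets such that every measurable part of their
    intersection outside [B] is null.  It rests on the Caratheodory
    measurability of half-spaces, which cut boxes into two boxes, and on the
    possibility of enlarging a box to an open one at a small cost in
    volume. *)

(** * Strategies *)

Lemma first_failure (P : nat -> Prop) : ~ (forall n, P n) ->
  exists n, ~ P n /\ forall m, (m < n)%N -> P m.
Proof.
move=> /existsNP[k nPk].
have ex : exists n, `[< ~ P n >] by exists k; exact/asboolP.
case: (ex_minnP ex) => n /asboolP nPn nmin; exists n; split=> // m mn.
by apply: contrapT => /asboolP/nmin; rewrite leqNgt mn.
Qed.

(** Let the two strategies play against each other: in the resulting run the
    first illegal move, if any, would have to belong to both players. *)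
Lemma strategies_not_both_winning {X Y : topologicalType}
    (Sigma : set (set X)) (f : X -> Y) :
  has_winning_strategyI Sigma f -> has_winning_strategyII Sigma f -> False.
Proof.
move=> [s winI] [t winII].
set W := first_set s.
(* [pos n] lists the moves made before move [n] of Player II. *)
pose pos := fix pos n := if n is n'.+1 then
    let: (Us, xs) := pos n' in
    let Us' := rcons Us (t W Us xs) in (Us', rcons xs (next_point s W Us' xs))
  else ([::], [::]).
pose U n := t W (pos n).1 (pos n).2.
pose x n := next_point s W (rcons (pos n).1 (U n)) (pos n).2.
have posE n : pos n = (mkseq U n, mkseq x n).
  elim: n => // n IH; rewrite !mkseqS -[mkseq U n]/(mkseq U n, mkseq x n).1.
  rewrite -[mkseq x n]/(mkseq U n, mkseq x n).2 -IH /= /x /U.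
  by case: (pos n).
pose r := Run W U x.
have fI : followsI s r by split=> // n; rewrite /= /x posE mkseqS.
have fII : followsII t r by move=> n; rewrite /= /U posE.
case: (winI r fI) => [[m [nII [lI mlt]]]|[lr np]];
  case: (winII r fII) => [[n [nI nlt]]|[lr' p']] //.
- have [mn|nm|mn] := ltngtP m n; last by rewrite -mn in nI.
    by have [_ ] := nlt _ mn.
  by have [] := mlt _ nm.
- by have [] := lr' m.
- by have [] := lr n.
Qed.

(** Player I opens with [W] and then alternates between [B] and [C].  A legal
    answer of Player II always leaves a point of the required kind, and two
    consecutive values are never [e]-close, so the values do not converge. *)
Lemma alternating_strategy_wins {R : realType} {X : topologicalType}
    {Y : pseudoMetricType R} (Sigma : set (set X)) (f : X -> Y)
    (W B C : set X) (e : R) :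
  positive_part Sigma W -> 0 < e ->
  (forall U, positive_part Sigma U -> U `<=` W -> U `&` B !=set0) ->
  (forall U, positive_part Sigma U -> U `<=` W -> U `&` C !=set0) ->
  (forall b c, B b -> C c -> ~ ball (f b) e (f c)) ->
  has_winning_strategyI Sigma f.
Proof.
move=> Wp e0 meetB meetC sep.
have [w Ww] : W !=set0.
  by have [w []] := meetB W Wp (@subset_refl _ W); exists w.
exists (StrategyI W (fun _ Us xs =>
  xget w (last set0 Us `&` (if odd (size xs) then C else B)))).
move=> r [rW rx].
have {}rx n : legalII Sigma r n ->
    (run_U r n `&` (if odd n then C else B)) (run_x r n).
  move=> [Up UW]; rewrite rx /next_point size_mkseq mkseqS last_rcons.
  apply: xgetPex; rewrite rW in UW.
  by case: ifP => _; [exact: meetC|exact: meetB].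
have legI n : (forall m, (m < n)%N -> legalII Sigma r m) -> legalI Sigma r n.
  by case: n => [|n] H /=; [rewrite rW|have [] := rx n (H _ (ltnSn n))].
have [lII|nlII] := pselect (forall n, legalII Sigma r n).
  right; split; first by move=> n; split => //; exact: legI.
  move=> [l [_ /cvg_ballP/(_ (e / 2))]]; rewrite divr_gt0// => /(_ isT)[N _ fl].
  have [_ xB] := rx N.*2 (lII _); have [_ xC] := rx N.*2.+1 (lII _).
  rewrite /= odd_double /= in xB xC.
  apply: (sep _ _ xB xC); apply: (@ball_splitr _ _ (f l)); apply: fl => /=.
    by rewrite -addnn leq_addr.
  by rewrite -addnn -addnS leq_addr.
left; have [n [nII ltII]] := first_failure _ nlII.
exists n; split=> //; split; first exact: legI.
move=> m mn; split; last exact: ltII.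
by apply: legI => j jm; apply: ltII; exact: ltn_trans mn.
Qed.

(** Closedness puts the limit of the points into every set played.  From stage
    [n] on, the values at the points and the value at the limit therefore lie in
    the image of one set, which has diameter at most [2/(n+1)]. *)
Lemma shrinking_strategy_wins {R : realType}
    {X : completePseudoMetricType R} {Y : pseudoMetricType R}
    (Sigma : set (set X)) (f : X -> Y) :
  (forall n U, positive_part Sigma U ->
    exists F, [/\ positive_part Sigma F, F `<=` U, closed F,
      exists c, F `<=` ball c n.+1%:R^-1 &
      exists y, f @` F `<=` ball y n.+1%:R^-1]) ->
  has_winning_strategyII Sigma f.
Proof.
move=> shrink.
pose good n (U F : set X) := [/\ positive_part Sigma F, F `<=` U, closed F,
      exists c, F `<=` ball c n.+1%:R^-1 &
      exists y, f @` F `<=` ball y n.+1%:R^-1].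
exists (fun W Us _ => xget set0 (good (size Us) (last W Us))) => r fol.
pose pred n := last (run_W r) (mkseq (run_U r) n).
have Ugood n : positive_part Sigma (pred n) -> good n (pred n) (run_U r n).
  by move=> /(shrink n) ex; rewrite fol size_mkseq; exact: xgetPex.
have [lI|nlI] := pselect (forall n, legalI Sigma r n); last first.
  left; have [n [nI ltI]] := first_failure _ nlI.
  exists n; split=> // m mn; split; first exact: ltI.
  have W0 : positive_part Sigma (run_W r).
    exact: (ltI 0 (leq_ltn_trans _ mn)).
  elim: m {mn} => [|m [Up UW]].
    by have [] := Ugood 0 W0.
  have [] := Ugood m.+1; rewrite /pred mkseqS last_rcons //.
  by move=> Up' UU _ _ _; split=> //; exact: subset_trans UU UW.
have W0 := lI 0.
have lII : forall n, legalII Sigma r n.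
  elim => [|m [Up UW]].
    by have [] := Ugood 0 W0.
  have [] := Ugood m.+1; rewrite /pred mkseqS last_rcons //.
  by move=> Up' UU _ _ _; split=> //; exact: subset_trans UU UW.
right; split => //.
have {}Ugood n : good n (pred n) (run_U r n).
  apply: Ugood; case: n => [|n]//; rewrite /pred mkseqS last_rcons.
  by have [] := lII n.
have Unest m n : (m <= n)%N -> run_U r n `<=` run_U r m.
  move=> /subnK <-; elim: (n - m)%N => // i IH.
  apply: subset_trans IH; rewrite addSn.
  by have [_ + _ _ _] := Ugood (i + m).+1; rewrite /pred mkseqS last_rcons.
have xU m n : (m <= n)%N -> run_U r m (run_x r n).
  by move=> mn; apply: (Unest m n mn); exact: (lI n.+1).
have small (e : R) : 0 < e -> exists n, n.+1%:R^-1 < e.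
  by move=> /ltr_add_invr[n]; rewrite add0r; exists n.
have /cauchy_cvgP/cvg_ex[l xl] : cauchy (run_x r @ \oo).
  apply: cauchy_exP => e /small[n ne].
  have [_ _ _ [c Uc] _] := Ugood n; exists c; exists n => // m /= nm.
  by apply: (le_ball (ltW ne)); exact: Uc (xU _ _ nm).
exists l; split=> //; apply/cvg_ballP => e e0.
have /small[n ne] : 0 < e / 2 by rewrite divr_gt0.
have [_ _ Uc _ [y fUy]] := Ugood n.
have Ul : run_U r n l.
  by apply: closed_cvg xl => //; exists n => // m; exact: xU.
exists n => // m /= nm; apply: (@ball_splitr _ _ y); apply: (le_ball (ltW ne)).
  by apply: fUy; exists l.
by apply: fUy; exists (run_x r m) => //; exact: xU.
Qed.

(** * Which player wins for a given function *)

Section SigmaAlgebra.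
Context {X : Type} {Sigma : set (set X)}.
Hypothesis HS : sigma_algebra [set: X] Sigma.

Lemma sigma_algebra_setC A : Sigma A -> Sigma (~` A).
Proof. by case: HS => _ + _ => /[apply]; rewrite setTD. Qed.

Lemma sigma_algebra_countable_bigcup {I : Type} (D : set I) (F : I -> set X) :
  countable D -> (forall i, D i -> Sigma (F i)) -> Sigma (\bigcup_(i in D) F i).
Proof.
have [S0 _ SU] := HS.
move=> /pfcard_geP[->|[g]] SF; first by rewrite bigcup_set0.
rewrite -(image_eq g) bigcup_image.
by apply: SU => i; apply: SF; exact: funS.
Qed.

Lemma sigma_algebra_countable_bigcap {I : Type} (D : set I) (F : I -> set X) :
  countable D -> (forall i, D i -> Sigma (F i)) -> Sigma (\bigcap_(i in D) F i).
Proof.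
move=> cD SF; rewrite -[X in Sigma X]setCK setC_bigcap.
apply: sigma_algebra_setC; apply: sigma_algebra_countable_bigcup => // i Di.
by apply: sigma_algebra_setC; exact: SF.
Qed.

Lemma sigma_algebra_setU A B : Sigma A -> Sigma B -> Sigma (A `|` B).
Proof.
move=> SA SB; rewrite -bigcup2E.
by apply: sigma_algebra_countable_bigcup => // -[|[|n]] _ //=; case: HS.
Qed.

Lemma sigma_algebra_setI A B : Sigma A -> Sigma B -> Sigma (A `&` B).
Proof.
move=> SA SB; rewrite -[X in Sigma X]setCK setCI.
by apply: sigma_algebra_setC; apply: sigma_algebra_setU;
  exact: sigma_algebra_setC.
Qed.

Lemma sigma_algebra_setD A B : Sigma A -> Sigma B -> Sigma (A `\` B).
Proof.
by move=> SA SB; apply: sigma_algebra_setI => //; exact: sigma_algebra_setC.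
Qed.

Lemma sub_hereditary_part A B :
  A `<=` B -> hereditary_part Sigma B -> hereditary_part Sigma A.
Proof. by move=> AB HB C CA; apply: HB; exact: subset_trans AB. Qed.

Lemma hereditary_part_bigcup {I : Type} (D : set I) (F : I -> set X) :
  countable D -> (forall i, D i -> hereditary_part Sigma (F i)) ->
  hereditary_part Sigma (\bigcup_(i in D) F i).
Proof.
move=> cD HF B /setIidPl <-; rewrite setI_bigcupr.
by apply: sigma_algebra_countable_bigcup => // i Di; apply: (HF i Di) => x [].
Qed.

Lemma hereditary_partU A B :
  hereditary_part Sigma A -> hereditary_part Sigma B ->
  hereditary_part Sigma (A `|` B).
Proof.
move=> HA HB; rewrite -bigcup2E.
by apply: hereditary_part_bigcup => // -[|[|n]] _ //= C; rewrite subset0 => ->;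
  case: HS.
Qed.

Lemma positive_part_split {I : Type} (D : set I) (F : I -> set X) (U : set X) :
  countable D -> (forall i, D i -> Sigma (F i)) ->
  positive_part Sigma U -> U `<=` \bigcup_(i in D) F i ->
  exists2 i, D i & positive_part Sigma (U `&` F i).
Proof.
move=> cD SF [SU HU] /setIidPl UF; apply: contrapT => noi; apply: HU.
rewrite -UF setI_bigcupr; apply: hereditary_part_bigcup => // i Di.
apply: contrapT => Hi; apply: noi; exists i => //; split=> //.
by apply: sigma_algebra_setI => //; exact: SF.
Qed.

End SigmaAlgebra.

(** Measurable hulls, with the measure of the error replaced by membership in
    the ideal [hereditary_part Sigma]. *)
Definition has_hulls {X : Type} (Sigma : set (set X)) : Prop :=
  forall B : set X, exists H : set X, [/\ Sigma H, B `<=` H &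
    forall U, Sigma U -> U `<=` H `\` B -> hereditary_part Sigma U].

(** The set [A m] collects the points whose value is at distance at least
    [1/(m+1)] from the complement of [V].  The sets [A m] exhaust the preimage
    of [V], so if their hulls [H m] all exceeded that preimage by a member of
    the ideal only, the preimage would be measurable.  For an [m] where this
    fails, every positive subset of a hull of the excess meets the excess, and
    if it lies in [H m] it meets [A m] as well. *)
Lemma nonmeasurable_winI {R : realType} {X : topologicalType}
    {Y : pseudoMetricType R} (Sigma : set (set X)) (f : X -> Y) :
  sigma_algebra [set: X] Sigma -> has_hulls Sigma ->
  ~ sigma_measurable Sigma f -> has_winning_strategyI Sigma f.
Proof.
move=> HS hull /existsNP[V /not_implyP[Vo nSA]].
pose A m := [set x | ball (f x) m.+1%:R^-1 `<=` V].
have AE : f @^-1` V = \bigcup_m A m.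
  apply/seteqP; split=> [x /= Vfx|x [m _]]; last by apply; exact: ballxx.
  have /nbhs_ballP[e /= e0 eV] : nbhs (f x) V by exact: open_nbhs_nbhs.
  have [m] := ltr_add_invr e0; rewrite add0r => me.
  by exists m => //; apply: subset_trans eV; apply: le_ball; exact: ltW.
have [H HE] := choice (fun m => hull (A m)).
have [m Hm] : exists m, ~ hereditary_part Sigma (H m `\` f @^-1` V).
  apply: contrapT => /forallNP allH; apply: nSA.
  have -> : f @^-1` V = \bigcup_m H m `\` \bigcup_m (H m `\` f @^-1` V).
    apply/seteqP; split=> [x Vx|x [[m _ Hx] /= nx]].
      split; last by move=> [m _ []].
      move: Vx; rewrite AE => -[m _ Ax]; exists m => //.
      by have [_ + _] := HE m; apply.
    by apply: contrapT => nV; apply: nx; exists m.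
  apply: sigma_algebra_setD => //;
    apply: sigma_algebra_countable_bigcup => // m _.
    by have [] := HE m.
  by have /contrapT := allH m; apply.
have [SH AH Hhull] := HE m.
have [K [SK CK Khull]] := hull (H m `\` f @^-1` V).
apply: (@alternating_strategy_wins _ _ _ Sigma f (H m `&` K) (A m)
  (H m `\` f @^-1` V) m.+1%:R^-1).
- split; first exact: sigma_algebra_setI.
  by apply: contra_not Hm; apply: sub_hereditary_part => x Cx; split;
    [have [] := Cx|exact: CK].
- by rewrite invr_gt0.
- move=> U [SU HU] UW; apply: contrapT => /set0P/negP/negPn/eqP UA.
  apply: HU; apply: Hhull => // x Ux; split; first by have [] := UW _ Ux.
  by move=> Ax; have : set0 x by rewrite -UA.
- move=> U [SU HU] UW; apply: contrapT => /set0P/negP/negPn/eqP UA.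
  apply: HU; apply: Khull => // x Ux; split; first by have [] := UW _ Ux.
  by move=> Ax; have : set0 x by rewrite -UA.
- by move=> b c bA [_ /= nVc] bc; apply: nVc; exact: bA.
Qed.

Definition has_positive_closed_subsets {X : topologicalType}
    (Sigma : set (set X)) : Prop :=
  forall U, positive_part Sigma U ->
    exists F, [/\ positive_part Sigma F, F `<=` U & closed F].

(** A positive set split into countably many measurable pieces has a positive
    piece: apply this to a cover by small sets and to the preimages of small
    balls centered in a countable dense set, then pass to a closed subset. *)
Lemma measurable_winII {R : realType} {X : completePseudoMetricType R}
    {Y : pseudoMetricType R} (Sigma : set (set X)) (f : X -> Y) :
  separable_space Y -> sigma_algebra [set: X] Sigma ->
  has_positive_closed_subsets Sigma ->
  (forall e : R, 0 < e -> exists (I : countType) (Q : I -> set X),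
    [/\ forall i, Sigma (Q i), \bigcup_i Q i = [set: X] &
        forall i, exists c, Q i `<=` ball c e]) ->
  sigma_measurable Sigma f -> has_winning_strategyII Sigma f.
Proof.
move=> [D [cD dD]] HS inner cells mf.
apply: shrinking_strategy_wins => n U Up.
have e0 : 0 < n.+1%:R^-1 :> R by rewrite invr_gt0.
have [I [Q [SQ QT Qc]]] := cells _ e0.
have [i _ UQ] : exists2 i, [set: I] i & positive_part Sigma (U `&` Q i).
  by apply: positive_part_split => //; rewrite QT.
pose P (y : Y) := f @^-1` (ball y n.+1%:R^-1)°.
have [y _ UQP] : exists2 y, D y & positive_part Sigma (U `&` Q i `&` P y).
  apply: positive_part_split => //.
    by move=> y _; apply: mf; exact: open_interior.
  (* Half the radius, so that [f x] is interior to the ball around [y]. *)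
  move=> x _; have [y [yfx Dy]] : (ball (f x) (n.+1%:R^-1 / 2))° `&` D !=set0.
    apply: dD; last exact: open_interior.
    by exists (f x); apply: nbhsx_ballx; rewrite divr_gt0.
  exists y => //; apply/nbhs_ballP; exists (n.+1%:R^-1 / 2).
    by rewrite /= divr_gt0.
  move=> z fxz; apply: (ball_split _ fxz); apply: ball_sym.
  exact: interior_subset yfx.
have [F [Fp FU Fc]] := inner _ UQP.
exists F; split=> //; first by move=> z /FU[[]].
  by have [c Qic] := Qc i; exists c => z /FU[[_ /Qic]].
by exists y => _ [z /FU[_ Pz] <-]; exact: interior_subset Pz.
Qed.

(** * The box outer measure *)

Section LebesgueOuterMeasure.
Context {R : realType} {k : nat}.
Implicit Types (A : set 'rV[R]_k).
Let mu := @lebesgue_outer_measure R k.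

Lemma box_volume_ge0 (a b : 'rV[R]_k) : 0 <= box_volume a b.
Proof. by apply: prodr_ge0 => i _; rewrite le_max lexx. Qed.

Lemma lebesgue_outer_measure_le_cover A D a b : box_cover A D a b ->
  (mu A <= \sum_(0 <= n <oo | D n) (box_volume (a n) (b n))%:E)%E.
Proof. by move=> AD; apply: ereal_inf_lbound; exists D, a, b. Qed.

Lemma lebesgue_outer_measure_near_cover A (e : R) :
  mu A \is a fin_num -> 0 < e ->
  exists D a b, box_cover A D a b /\
    (\sum_(0 <= n <oo | D n) (box_volume (a n) (b n))%:E <= mu A + e%:E)%E.
Proof.
move=> Afin e0.
have [_ [D [a [b [AD ->]]]] lt] := lb_ereal_inf_adherent e0 Afin.
by exists D, a, b; split=> //; exact: ltW.
Qed.

Lemma lebesgue_outer_measure_set0 : mu set0 = 0%E.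
Proof.
apply/eqP; rewrite eq_le; apply/andP; split; last first.
  apply: le_ereal_inf_tmp => _ [D [a [b [_ ->]]]].
  by apply: nneseries_ge0 => n _ _; rewrite lee_fin box_volume_ge0.
have := @lebesgue_outer_measure_le_cover set0 pred0 (fun=> 0) (fun=> 0).
by rewrite eseries_pred0 //; apply => x.
Qed.

Lemma lebesgue_outer_measure_ge0 A : (0 <= mu A)%E.
Proof.
apply: le_ereal_inf_tmp => _ [D [a [b [_ ->]]]].
by apply: nneseries_ge0 => n _ _; rewrite lee_fin box_volume_ge0.
Qed.

(** A doubly indexed family of boxes is a cover too, through a bijection between
    pairs of naturals and naturals. *)
Lemma lebesgue_outer_measure_le_covers A (D : nat -> pred nat)
    (a b : nat -> nat -> 'rV[R]_k) :
  (forall x, A x -> exists n m, D n m /\ box (a n m) (b n m) x) ->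
  (mu A <= \sum_(0 <= n <oo)
     \sum_(0 <= m <oo | D n m) (box_volume (a n m) (b n m))%:E)%E.
Proof.
move=> AD; have /card_esym/ppcard_eqP[g] := card_nat2.
pose D' i := D (g i).1 (g i).2.
pose a' i := a (g i).1 (g i).2; pose b' i := b (g i).1 (g i).2.
have ->: (\sum_(0 <= n <oo)
     \sum_(0 <= m <oo | D n m) (box_volume (a n m) (b n m))%:E)%E =
     (\sum_(0 <= i <oo | D' i) (box_volume (a' i) (b' i))%:E)%E.
  rewrite nneseries_esumT; last first.
    by move=> n; apply: nneseries_ge0 => m _ _; rewrite lee_fin box_volume_ge0.
  pose v n m := (box_volume (a n m) (b n m))%:E.
  have v0 n m : (0 <= v n m)%E by rewrite lee_fin box_volume_ge0.
  have -> := eq_esum (fun n (_ : setT n) =>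
    nneseries_esum (P := D n) (fun m _ => v0 n m)).
  rewrite esum_esum; last by move=> n m _ _; rewrite lee_fin box_volume_ge0.
  rewrite nneseries_esum; last by move=> n _; rewrite lee_fin box_volume_ge0.
  apply: (reindex_esum [set i | D' i] _ g (fun p => v p.1 p.2)).
  split => //=.
  - by move=> i j _ _; apply: (@inj _ _ _ g); rewrite inE.
  - move=> p [_ Dp]; have [i _ gi] := @surj _ _ _ _ g p I.
    by exists i => //=; rewrite /D' gi.
apply: lebesgue_outer_measure_le_cover => x /AD[n [m [Dnm xb]]].
have [i _ gi] := @surj _ _ _ _ g (n, m) I.
by exists i; rewrite /= /D' /a' /b' gi.
Qed.

Lemma lebesgue_outer_measure_subadditive A (F : nat -> set 'rV[R]_k) :
  subset_sigma_subadditive mu A F.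
Proof.
move=> AF; have [[n Fn]|/forallNP Ffin] := pselect (exists n, mu (F n) = +oo%E).
  rewrite (nneseries_pinfty _ _ Fn) ?leey// => m _.
  exact: lebesgue_outer_measure_ge0.
apply/lee_addgt0Pr => e e0.
have en0 n : 0 < e / (2 ^ n.+1)%:R by rewrite divr_gt0// ltr0n expn_gt0.
have Ffin' n : mu (F n) \is a fin_num.
  by rewrite ge0_fin_numE ?lebesgue_outer_measure_ge0// ltey; apply/eqP.
have [c Hc] := choice (fun n =>
  lebesgue_outer_measure_near_cover _ _ (Ffin' n) (en0 n)).
have [a Ha] := choice Hc; have [b Hb] := choice Ha.
apply: (le_trans (@lebesgue_outer_measure_le_covers A c a b _)).
  move=> x /AF[n _ Fx]; have [/(_ x Fx)[m cm xb] _] := Hb n.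
  by exists n, m.
apply: le_trans (epsilon_trick xpredT _ (ltW e0)).
  apply: lee_nneseries => [n _ _|n _]; last by have [] := Hb n.
  by apply: nneseries_ge0 => m _ _; rewrite lee_fin box_volume_ge0.
by move=> n; exact: lebesgue_outer_measure_ge0.
Qed.

HB.instance Definition _ := isSubsetOuterMeasure.Build R 'rV[R]_k mu
  lebesgue_outer_measure_set0 lebesgue_outer_measure_ge0
  lebesgue_outer_measure_subadditive.

End LebesgueOuterMeasure.

(** * Regularity of Lebesgue measurable sets *)

Section LebesgueSigmaAlgebra.
Context {R : realType} {k : nat}.
Let mu := @lebesgue_outer_measure R k.

Lemma Leb_sigma_algebra : sigma_algebra [set: 'rV[R]_k] (@Leb R k).
Proof.
split; first exact: caratheodory_measurable_set0.
  by move=> A LA; rewrite setTD; exact: caratheodory_measurable_setC.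
exact: caratheodory_measurable_bigcup.
Qed.

Lemma null_hereditary_part N : mu N = 0%E -> hereditary_part (@Leb R k) N.
Proof.
move=> N0 B BN; apply: le_caratheodory_measurable => X.
have XB0 : mu (X `&` B) = 0%E.
  apply/eqP; rewrite eq_le outer_measure_ge0 andbT -N0.
  by apply: le_outer_measure => x [_ /BN].
by rewrite [X in (X + _)%E]XB0 add0e; apply: le_outer_measure => x [].
Qed.

Definition set_coord (v : 'rV[R]_k) (i : 'I_k) (c : R) : 'rV[R]_k :=
  \row_j if j == i then c else v ord0 j.

Lemma box_halfspace (a b : 'rV[R]_k) (i : 'I_k) (c : R) :
  box a b `&` [set x | x ord0 i <= c] =
  box a (set_coord b i (Num.min (b ord0 i) c)).
Proof.
apply/seteqP; split=> x /=.
  move=> [xab xc] j; rewrite mxE; case: eqP => [->|//].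
  by rewrite le_min xc; have /andP[-> ->] := xab i.
move=> xab; split; last first.
  by have := xab i; rewrite mxE eqxx le_min => /and3P[].
move=> j; have := xab j; rewrite mxE; case: eqP => [->|//].
by rewrite le_min => /and3P[-> ->].
Qed.

Lemma box_halfspaceC (a b : 'rV[R]_k) (i : 'I_k) (c : R) :
  box a b `&` ~` [set x | x ord0 i <= c] =
  box (set_coord a i (Num.max (a ord0 i) c)) b.
Proof.
apply/seteqP; split=> x /=.
  move=> [xab /negP]; rewrite -ltNge => xc j; rewrite mxE.
  case: eqP => [->|//].
  by rewrite gt_max xc; have /andP[-> ->] := xab i.
move=> xab; split; last first.
  have := xab i; rewrite mxE eqxx gt_max => /andP[/andP[_ cx] _].
  by apply/negP; rewrite -ltNge.
move=> j; have := xab j; rewrite mxE; case: eqP => [->|//].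
by rewrite gt_max => /andP[/andP[-> _] ->].
Qed.

Lemma box_volume_halfspace (a b : 'rV[R]_k) (i : 'I_k) (c : R) :
  box_volume a b = box_volume a (set_coord b i (Num.min (b ord0 i) c)) +
                   box_volume (set_coord a i (Num.max (a ord0 i) c)) b.
Proof.
pose g j := Num.max 0 (b ord0 j - a ord0 j).
have volD (u v : 'rV[R]_k) :
    (forall j, j != i -> u ord0 j = a ord0 j /\ v ord0 j = b ord0 j) ->
    box_volume u v =
      Num.max 0 (v ord0 i - u ord0 i) * \prod_(j < k | j != i) g j.
  move=> uv; rewrite /box_volume (bigD1 i)//=; congr (_ * _).
  by apply: eq_bigr => j /uv[-> ->].
rewrite !volD//; try by move=> j /negPf ji; rewrite mxE ji.
rewrite !mxE eqxx -mulrDl; congr (_ * _); set p := a _ _; set q := b _ _.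
have [qc|cq] := leP q c.
  rewrite [Num.max 0 (q - Num.max p c)]max_l ?addr0//.
  by rewrite subr_le0 le_max qc orbT.
have [pc|cp] := leP p c.
  rewrite !max_r ?subr_ge0//; [by rewrite [RHS]addrC subrKA|exact: ltW|].
  exact: le_trans (ltW cq).
by rewrite [Num.max 0 (c - p)]max_l ?add0r// subr_le0 ltW.
Qed.

(** A half-space cuts each box of a cover into two boxes whose volumes add
    up, so a cover of [A] yields covers of both parts of [A] with the same total
    volume. *)
Lemma Leb_halfspace (i : 'I_k) (c : R) :
  Leb [set x : 'rV[R]_k | x ord0 i <= c].
Proof.
apply: le_caratheodory_measurable => A.
apply: le_ereal_inf_tmp => _ [D [a [b [AD ->]]]].
pose bmin n := set_coord (b n) i (Num.min (b n ord0 i) c).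
pose amax n := set_coord (a n) i (Num.max (a n ord0 i) c).
apply: (@le_trans _ _
  (\sum_(0 <= n <oo | D n) (box_volume (a n) (bmin n))%:E +
   \sum_(0 <= n <oo | D n) (box_volume (amax n) (b n))%:E)%E).
  apply: leeD; apply: lebesgue_outer_measure_le_cover => x [/AD[n Dn xab] xc];
    exists n => //.
    by rewrite -box_halfspace.
  by rewrite -box_halfspaceC.
rewrite -nneseriesD; try by move=> n _ _; rewrite lee_fin box_volume_ge0.
rewrite le_eqVlt; apply/orP; left; apply/eqP; apply: eq_eseriesr => n _.
by rewrite -EFinD -box_volume_halfspace.
Qed.

Lemma Leb_open_halfspace (i : 'I_k) (c : R) :
  Leb [set x : 'rV[R]_k | x ord0 i < c].
Proof.
have -> : [set x : 'rV[R]_k | x ord0 i < c] =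
    \bigcup_n [set x | x ord0 i <= c - n.+1%:R^-1].
  apply/seteqP; split=> [x /= /ltr_add_invr[n xn]|x [n _ /=]].
    by exists n => //=; rewrite lerBrDr ltW.
  by move=> /le_lt_trans; apply; rewrite ltrBlDr ltrDl invr_gt0.
by have [_ _ SU] := Leb_sigma_algebra; apply: SU => n; exact: Leb_halfspace.
Qed.

Definition open_box (a b : 'rV[R]_k) : set 'rV[R]_k :=
  [set x | forall i, a ord0 i < x ord0 i < b ord0 i].

Definition closed_box (a b : 'rV[R]_k) : set 'rV[R]_k :=
  [set x | forall i, a ord0 i <= x ord0 i <= b ord0 i].

Lemma Leb_forall_coord (P : 'I_k -> set 'rV[R]_k) :
  (forall i, Leb (P i)) -> Leb [set x | forall i, P i x].
Proof.
move=> LP; have -> : [set x | forall i, P i x] = \bigcap_i P i.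
  by apply/seteqP; split=> [x Px i _|x Px i]; [exact: Px|exact: Px i I].
exact: (sigma_algebra_countable_bigcap Leb_sigma_algebra).
Qed.

Lemma Leb_open_box a b : Leb (open_box a b).
Proof.
have HS := Leb_sigma_algebra.
apply: (Leb_forall_coord (fun i x => a ord0 i < x ord0 i < b ord0 i)) => i.
rewrite [X in Leb X](_ : _ =
    [set x : 'rV[R]_k | x ord0 i < b ord0 i] `\`
    [set x : 'rV[R]_k | x ord0 i <= a ord0 i]).
  apply: (sigma_algebra_setD HS).
    exact: Leb_open_halfspace.
  exact: Leb_halfspace.
apply/seteqP; split=> x /=.
  by move=> /andP[ax ->]; split=> //; apply/negP; rewrite -ltNge.
by move=> [-> /negP]; rewrite -ltNge => ->.
Qed.

Lemma Leb_closed_box a b : Leb (closed_box a b).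
Proof.
have HS := Leb_sigma_algebra.
apply: (Leb_forall_coord (fun i x => a ord0 i <= x ord0 i <= b ord0 i)) => i.
rewrite [X in Leb X](_ : _ =
    [set x : 'rV[R]_k | x ord0 i <= b ord0 i] `\`
    [set x : 'rV[R]_k | x ord0 i < a ord0 i]).
  apply: (sigma_algebra_setD HS).
    exact: Leb_halfspace.
  exact: Leb_open_halfspace.
apply/seteqP; split=> x /=.
  by move=> /andP[ax ->]; split=> //; apply/negP; rewrite -leNgt.
by move=> [-> /negP]; rewrite -leNgt => ->.
Qed.

Lemma closed_closed_box a b : closed (closed_box a b).
Proof.
have -> : closed_box a b = \bigcap_(i in [set: 'I_k])
    ((fun x : 'rV[R]_k => x ord0 i) @^-1` [set t | a ord0 i <= t] `&`
     (fun x : 'rV[R]_k => x ord0 i) @^-1` [set t | t <= b ord0 i]).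
  apply/seteqP; split=> [x xab i _|x xab i]; first exact/andP.
  exact/andP/(xab i I).
apply: closed_bigI => i _; apply: closedI; apply: preimage_closed.
- by move=> x _; exact: coord_continuous.
- exact: closed_ge.
- by move=> x _; exact: coord_continuous.
- exact: closed_le.
Qed.

Lemma open_open_box a b : open (open_box a b).
Proof.
rewrite openE => x xab.
suff : forall i, nbhs x [set y | a ord0 i < y ord0 i < b ord0 i].
  by move=> xab_near; exact: (@filter_forall _ _ _ (nbhs x) _ xab_near).
move=> i.
have /(_ [set t | a ord0 i < t < b ord0 i]) := @coord_continuous R 1 k ord0 i x.
apply; have : x ord0 i \in `]a ord0 i, b ord0 i[ by rewrite in_itv /= xab.
by move=> /near_in_itvoo; apply: filterS => t; rewrite in_itv.
Qed.

Lemma lebesgue_outer_measure_box a b :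
  (mu (box a b) <= (box_volume a b)%:E)%E.
Proof.
apply: le_trans
  (lebesgue_outer_measure_le_cover _ (pred1 0%N) (fun=> a) (fun=> b) _) _.
  by move=> x xab; exists 0%N => //=.
rewrite nneseries_esum; last by move=> n _; rewrite lee_fin box_volume_ge0.
rewrite (_ : [set _ | _] = [set 0%N]) ?esum_set1 ?lee_fin ?box_volume_ge0//.
by apply/seteqP; split=> n /= /eqP.
Qed.

Lemma cvg_prod {T I : Type} {F : set_system T} {FF : Filter F} (s : seq I)
    (u : I -> T -> R) (l : I -> R) :
  (forall i, u i @ F --> l i) ->
  \prod_(i <- s) u i t @[t --> F] --> \prod_(i <- s) l i.
Proof.
move=> ul; elim: s => [|i s IH].
  by under eq_fun do rewrite big_nil; rewrite big_nil; exact: cvg_cst.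
by under eq_fun do rewrite big_cons; rewrite big_cons; exact: cvgM.
Qed.

(** The volume depends continuously on the upper corner. *)
Lemma box_enlarge (a b : 'rV[R]_k) (e : R) : 0 < e ->
  exists b' : 'rV[R]_k, box a b `<=` open_box a b' /\
    box_volume a b' <= box_volume a b + e.
Proof.
move=> e0; pose b' n : 'rV[R]_k := \row_j (b ord0 j + n.+1%:R^-1).
have cvgv : box_volume a (b' n) @[n --> \oo] --> box_volume a b.
  apply: cvg_prod => i; under eq_fun do rewrite mxE.
  have cvgb : (b ord0 i + n.+1%:R^-1 - a ord0 i) @[n --> \oo] -->
      b ord0 i - a ord0 i.
    rewrite -[X in X - _]addr0; apply: cvgB; last exact: cvg_cst.
    by apply: cvgD; [exact: cvg_cst|exact: cvg_harmonic].
  have hc : {for b ord0 i - a ord0 i, continuous (fun t : R => Num.max 0 t)}.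
    apply: (@continuous_max R R (cst 0) id); last exact: cvg_id.
    exact: cst_continuous.
  exact: (continuous_cvg _ hc cvgb).
have /cvgrPdist_le/(_ _ e0)[N _ /(_ N (leqnn N))] := cvgv.
rewrite ler_distlC => /andP[_ vN]; exists (b' N); split=> // x xab i.
by have /andP[-> /le_lt_trans->//] := xab i; rewrite mxE ltrDl invr_gt0.
Qed.

(** Take a nearly optimal cover and enlarge its boxes to open ones, spending
    [e / 2] on each of the two approximations. *)
Lemma outer_regular (B : set 'rV[R]_k) (e : R) : mu B \is a fin_num -> 0 < e ->
  exists G, [/\ open G, Leb G, B `<=` G & (mu G <= mu B + e%:E)%E].
Proof.
move=> Bfin e0; have e20 : 0 < e / 2 by rewrite divr_gt0.
have [D [a [b [BD sumab]]]] := lebesgue_outer_measure_near_cover _ _ Bfin e20.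
have en0 n : 0 < e / 2 / (2 ^ n.+1)%:R by rewrite divr_gt0// ltr0n expn_gt0.
have [b' b'E] := choice (fun n => box_enlarge (a n) (b n) _ (en0 n)).
exists (\bigcup_(n in [set n | D n]) open_box (a n) (b' n)); split.
- by apply: bigcup_open => n _; exact: open_open_box.
- apply: (sigma_algebra_countable_bigcup Leb_sigma_algebra) => [|n _].
    exact: countableP.
  exact: Leb_open_box.
- by move=> x /BD[n Dn xab]; exists n => //; have [+ _] := b'E n; apply.
apply: le_trans (lebesgue_outer_measure_le_cover _ D a b' _) _.
  move=> x [n Dn xab]; exists n => // i.
  by have /andP[-> /ltW->] := xab i.
rewrite [e]splitr EFinD addeA; apply: le_trans (leeD2r _ sumab).
apply: le_trans (epsilon_trick _ _ (ltW e20)); last first.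
  by move=> n; rewrite lee_fin box_volume_ge0.
apply: lee_nneseries => [n _ _|n _]; first by rewrite lee_fin box_volume_ge0.
by rewrite -EFinD lee_fin; have [] := b'E n.
Qed.

(** Cutting [G n] along a measurable [U] that is disjoint from [B] gives
    [mu U + mu B <= mu (G n) <= mu B + 1/(n+1)], whence [mu U = 0]. *)
Lemma outer_regular_null (B : set 'rV[R]_k) : mu B \is a fin_num ->
  exists G : nat -> set 'rV[R]_k,
    (forall n, [/\ open (G n), Leb (G n) & B `<=` G n]) /\
    forall U, Leb U -> U `<=` \bigcap_n G n `\` B ->
      hereditary_part (@Leb R k) U.
Proof.
move=> Bfin; have n0 n : 0 < n.+1%:R^-1 :> R by rewrite invr_gt0.
have [G GE] := choice (fun n => outer_regular B _ Bfin (n0 n)).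
exists G; split; first by move=> n; have [] := GE n.
move=> U LU UG; apply: null_hereditary_part.
apply/eqP; rewrite eq_le outer_measure_ge0 andbT; apply/lee_addgt0Pr => e e0.
have [n] := ltr_add_invr e0; rewrite !add0r => ne.
have [_ _ BG muG] := GE n; rewrite -(@leeD2lE _ (mu B))//.
apply: (@le_trans _ _ (mu B + n.+1%:R^-1%:E)%E); last first.
  by rewrite leeD2l// lee_fin ltW.
have -> : (mu B + mu U)%E = (mu U + mu B)%E by rewrite addeC.
apply: le_trans muG.
have -> : mu (G n) = (mu (G n `&` U) + mu (G n `&` ~` U))%E := LU (G n).
apply: leeD; apply: le_outer_measure => x.
  by move=> Ux; split=> //; have [+ _] := UG _ Ux; apply.
by move=> Bx; split; [exact: BG|move=> /UG[]].
Qed.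

Lemma lebesgue_outer_measure_closed_box a b : (mu (closed_box a b) < +oo)%E.
Proof.
pose a' : 'rV[R]_k := \row_j (a ord0 j - 1).
apply: (@le_lt_trans _ _ (box_volume a' b)%:E); last exact: ltry.
apply: le_trans (lebesgue_outer_measure_box a' b); apply: le_outer_measure.
move=> x xab i; have /andP[ax ->] := xab i.
by rewrite mxE andbT (lt_le_trans _ ax)// ltrBlDr ltrDl.
Qed.

(** Closed cells of side [d] serve twice: for [d = 1] they cut the space into
    pieces of finite outer measure, and for small [d] they are the small pieces
    between which Player II chooses. *)
Definition grid_cell (d : R) (z : 'rV[int]_k) : set 'rV[R]_k :=
  closed_box (\row_j (d * (z ord0 j)%:~R)) (\row_j (d * (z ord0 j + 1)%:~R)).

Lemma bigcup_grid_cell (d : R) : 0 < d -> \bigcup_z grid_cell d z = setT.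
Proof.
move=> d0; rewrite -subTset => x _.
exists (\row_j Num.floor (d^-1 * x ord0 j)) => // i; rewrite !mxE.
have /andP[l r] := floor_itv (d^-1 * x ord0 i).
by rewrite -ler_pdivlMl// l -ler_pdivrMl// ltW.
Qed.

Lemma grid_cell_sub_ball (d e : R) (z : 'rV[int]_k) : 0 < d -> d < e ->
  grid_cell d z `<=` ball (\row_j (d * (z ord0 j)%:~R) : 'rV[R]_k) e.
Proof.
move=> d0 de x xz; split; first exact: lt_trans de.
move=> i j; rewrite (ord1 i); have := xz j; rewrite !mxE intrD mulrDr mulr1.
move=> /andP[zx xzd]; rewrite /ball /= distrC ger0_norm ?subr_ge0//.
by rewrite ltrBlDl; apply: le_lt_trans xzd _; rewrite ltrD2l.
Qed.

(** Approximate the part of [B] in each cell of side 1 and take the union; a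
    measurable subset of the union that avoids [B] splits into countably many
    members of the ideal. *)
Lemma Leb_has_hulls : has_hulls (@Leb R k).
Proof.
have HS := Leb_sigma_algebra; move=> B; pose Q := grid_cell 1.
have BQfin z : mu (B `&` Q z) \is a fin_num.
  rewrite ge0_fin_numE ?lebesgue_outer_measure_ge0//.
  apply: le_lt_trans (lebesgue_outer_measure_closed_box _ _).
  by apply: le_outer_measure; exact: subIsetr.
have [G GE] := choice (fun z => outer_regular_null _ (BQfin z)).
have LG z : Leb (\bigcap_n G z n).
  apply: (sigma_algebra_countable_bigcap HS) => // n _.
  by have [/(_ n)[]] := GE z.
exists (\bigcup_z \bigcap_n G z n); split.
- apply: (sigma_algebra_countable_bigcup HS) => // z _; exact: LG.
- move=> x Bx; have [z _ Qx] : (\bigcup_z Q z) x by rewrite bigcup_grid_cell.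
  by exists z => // n _; have [/(_ n)[_ _ BG] _] := GE z; exact: BG.
- move=> U LU UH; have -> : U = \bigcup_z (U `&` \bigcap_n G z n).
    rewrite -setI_bigcupr; apply/esym/setIidPl; apply: subset_trans UH _.
    by move=> x [].
  apply: (hereditary_part_bigcup HS) => [|z _]; first exact: countableP.
  have [_ Gnull] := GE z; apply: Gnull; first exact: (sigma_algebra_setI HS).
  by move=> x [Ux Gx]; split=> // -[Bx _]; have [] := UH _ Ux.
Qed.

(** Inside a cell [Q] where [U] is positive, let [P] be the part of [U] and
    approximate [Q `\` P] from outside by open sets [G n].  The sets [Q `\` G n]
    are closed subsets of [P] that exhaust it up to a member of the ideal, so
    one of them is positive. *)
Lemma Leb_has_positive_closed_subsets :
  has_positive_closed_subsets (@Leb R k).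
Proof.
have HS := Leb_sigma_algebra; move=> U Up.
have [z _ [LP HP]] : exists2 z, [set: 'rV[int]_k] z &
    positive_part (@Leb R k) (U `&` grid_cell 1 z).
  apply: (positive_part_split HS _ _ _ _ _ Up) => [|z _|].
  - exact: countableP.
  - exact: Leb_closed_box.
  - by rewrite bigcup_grid_cell.
set Q := grid_cell 1 z in LP HP; set P := U `&` Q in LP HP.
have QPfin : mu (Q `\` P) \is a fin_num.
  rewrite ge0_fin_numE ?lebesgue_outer_measure_ge0//.
  apply: le_lt_trans (lebesgue_outer_measure_closed_box _ _).
  by apply: le_outer_measure; exact: subDsetl.
have [G [GE Gnull]] := outer_regular_null _ QPfin.
have QGP n : Q `\` G n `<=` P.
  move=> x [Qx nGx]; apply: contrapT => nPx; apply: nGx.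
  by have [_ _] := GE n; apply.
have [n HF] : exists n, ~ hereditary_part (@Leb R k) (Q `\` G n).
  apply: contrapT => /forallNP allH; apply: HP.
  apply: (@sub_hereditary_part _ _ _
      ((P `&` \bigcap_n G n) `|` \bigcup_n (Q `\` G n))).
    move=> x Px; have [Gx|] := pselect ((\bigcap_n G n) x); first by left.
    move=> /existsNP[n /not_implyP[_ nGx]]; right; exists n => //.
    by split=> //; have [] := Px.
  apply: (hereditary_partU HS).
    apply: Gnull; last by move=> x [Px Gx]; split=> // -[].
    apply: (sigma_algebra_setI HS) => //.
    by apply: (sigma_algebra_countable_bigcap HS) => // n _; have [] := GE n.
  apply: (hereditary_part_bigcup HS) => [|n _]; first exact: countableP.
  exact: contrapT (allH n).
have [Go LG _] := GE n.
exists (Q `\` G n); split.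
- by split=> //; apply: (sigma_algebra_setD HS) => //; exact: Leb_closed_box.
- by move=> x /QGP[].
- by apply: closedI; [exact: closed_closed_box|exact: open_closedC].
Qed.

End LebesgueSigmaAlgebra.

Theorem theorem13 (R : realType) (k : nat) (Y : metricType R)
    (f : 'rV[R]_k -> Y) (Ysep : separable_space Y) :
  determined (@Leb R k) f /\
  (has_winning_strategyI (@Leb R k) f <-> ~ sigma_measurable (@Leb R k) f) /\
  (has_winning_strategyII (@Leb R k) f <-> sigma_measurable (@Leb R k) f).
Proof.
have HS := @Leb_sigma_algebra R k.
have winI :
    ~ sigma_measurable (@Leb R k) f -> has_winning_strategyI (@Leb R k) f.
  exact: (nonmeasurable_winI _ _ HS Leb_has_hulls).
have winII :
    sigma_measurable (@Leb R k) f -> has_winning_strategyII (@Leb R k) f.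
  apply: (measurable_winII _ _ Ysep HS Leb_has_positive_closed_subsets).
  move=> e e0; have e20 : 0 < e / 2 by rewrite divr_gt0.
  exists 'rV[int]_k, (grid_cell (e / 2)); split.
  - by move=> z; exact: Leb_closed_box.
  - exact: bigcup_grid_cell.
  - move=> z; eexists; apply: grid_cell_sub_ball => //.
    by rewrite ltr_pdivrMr// ltr_pMr// ltr1n.
have excl := @strategies_not_both_winning _ _ (@Leb R k) f.
split.
  by have [mf|nmf] := pselect (sigma_measurable (@Leb R k) f);
    [right; exact: winII|left; exact: winI].
split; split=> //; first by move=> wI mf; exact: excl wI (winII mf).
by move=> wII; apply: contrapT => nmf; exact: excl (winI nmf) wII.
Qed.
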